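(* Let $V$ be an arbitrary vector space over a field $k$. The binary relation $\leq^{1GD}$ is a partial order (reflexive, antisymmetric and transitive) on the set of finite potent endomorphisms of $V$.
   Context: $k$ is an arbitrary field, $V$ an arbitrary (possibly infinite-dimensional) $k$-vector space. An endomorphism $\varphi\in\mathrm{End}_k(V)$ is finite potent if $\varphi^n(V)$ is finite dimensional for some $n\ge 1$. For such $\varphi$ there is a unique $\varphi$-invariant decomposition $V=W_\varphi\oplus U_\varphi$ (the AST decomposition) with $W_\varphi$ finite dimensional, $\varphi|_{W_\varphi}$ an automorphism of $W_\varphi$, and $\varphi|_{U_\varphi}$ nilpotent; the index $m=i(\varphi)$ is the nilpotency order of $\varphi|_{U_\varphi}$ ($i(\varphi)=0$ iff $V$ is finite dimensional and $\varphi$ is an automorphism). A $\{1\}$-inverse of $\varphi$ is $\varphi^-\in\mathrm{End}_k(V)$ with $\varphi\varphi^-\varphi=\varphi$; the set of them is $X_\varphi(1)$. A G-Drazin inverse of $\varphi$ is $\varphi^{GD}\in\mathrm{End}_k(V)$ with $\varphi\varphi^{GD}\varphi=\varphi$ and $\varphi^{GD}\varphi^m=\varphi^m\varphi^{GD}$; the set of them is $X_\varphi(GD)$. $X_\varphi(1GD)$ is the set of 1GD inverses of $\varphi$: those $\chi\in\mathrm{End}_k(V)$ such that $\chi\varphi\chi=\chi$, $\chi\varphi=\varphi^-\varphi$ and $\varphi\chi=\varphi\varphi^{GD}$ for some $\varphi^-\in X_\varphi(1)$, $\varphi^{GD}\in X_\varphi(GD)$. For finite potent $\varphi,\psi\in\mathrm{End}_k(V)$: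 $\varphi\leq^{1GD}\psi$ means that there are $\hat\varphi^{1GD},\tilde\varphi^{1GD}\in X_\varphi(1GD)$ with $\varphi\hat\varphi^{1GD}=\psi\hat\varphi^{1GD}$ and $\tilde\varphi^{1GD}\varphi=\tilde\varphi^{1GD}\psi$. *)

(* Defs.v *)
From mathcomp Require Import all_boot all_order all_algebra.
From mathcomp Require Import boolp classical_sets functions.

Set Implicit Arguments.
Unset Strict Implicit.
Unset Printing Implicit Defensive.

Import GRing.Theory.

Local Open Scope classical_set_scope.
Local Open Scope ring_scope.

Section FinitePotent.
Variables (k : fieldType) (V : lmodType k).
Implicit Types (phi psi chi : {linear V -> V}) (W U : set V) (m n : nat).

Definition subspace W : Prop := submod_closed (mem W).

Definition linear_span n (b : 'I_n -> V) : set V :=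
  [set v | exists c : 'I_n -> k, v = \sum_(i < n) c i *: b i].

Definition linearly_independent n (b : 'I_n -> V) : Prop :=
  forall c : 'I_n -> k, \sum_(i < n) c i *: b i = 0 -> forall i, c i = 0.

Definition finite_dimensional W : Prop :=
  exists n (b : 'I_n -> V), linearly_independent b /\ W = linear_span b.

Definition direct_sum_decomposition W U : Prop :=
  [/\ W `&` U = [set 0] & forall v, exists w u, [/\ W w, U u & v = w + u]].

Definition invariant phi W : Prop := set_fun W W phi.

(* phi ^ n restricted to U is zero; for n = 0 this says U = 0. *)
Definition power_zero_on phi U n : Prop := forall u, U u -> iter n phi u = 0.

Definition nilpotent_on phi U : Prop := exists n, power_zero_on phi U n.

Definition nilpotency_order phi U m : Prop :=
  power_zero_on phi U m /\ forall n, power_zero_on phi U n -> (m <= n)%N.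

Definition finite_potent phi : Prop :=
  exists2 n, (0 < n)%N & finite_dimensional (range (iter n phi)).

Definition AST_decomposition phi W U : Prop :=
  [/\ subspace W /\ subspace U,
      direct_sum_decomposition W U,
      invariant phi W /\ invariant phi U,
      finite_dimensional W /\ set_bij W W phi
    & nilpotent_on phi U].

(* The index is kept as a relation: the AST decomposition of a finite potent
   endomorphism exists and is unique, so it then holds of exactly one m. *)
Definition is_index phi m : Prop :=
  exists W U, AST_decomposition phi W U /\ nilpotency_order phi U m.

Definition inverse1 phi chi : Prop := phi \o chi \o phi =1 phi.

Definition GDrazin_inverse phi chi : Prop :=
  inverse1 phi chi /\
  exists2 m, is_index phi m & chi \o iter m phi =1 iter m phi \o chi.

Definition inverse1GD phi chi : Prop :=
  chi \o phi \o chi =1 chi /\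
  exists phi1 phiGD : {linear V -> V},
    [/\ inverse1 phi phi1, GDrazin_inverse phi phiGD,
        chi \o phi =1 phi1 \o phi & phi \o chi =1 phi \o phiGD].

Definition le1GD phi psi : Prop :=
  exists chi1 chi2 : {linear V -> V},
    [/\ inverse1GD phi chi1, inverse1GD phi chi2,
        phi \o chi1 =1 psi \o chi1 & chi2 \o phi =1 chi2 \o psi].

End FinitePotent.

(* Main.v *)
(* Write [a], [b] for the two inverses of phi witnessing phi <= psi, and [c],
   [d] for those of psi witnessing psi <= omega; then [c psi a] and [b psi d]
   witness phi <= omega. The only delicate point is that [b psi d] comes from a
   G-Drazin inverse of phi, i.e. that phi^m psi d = phi^m with m = i(phi). Now
   psi^m' psi d = psi^m' with m' = i(psi), and phi^m phi = phi^m psi, so that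
   phi^(m + m') psi d = phi^m psi^m' psi d = phi^(m + m'); phi^m' can be
   cancelled because ker phi^(m + m') = ker phi^m.
   For reflexivity, if [g] is a G-Drazin inverse of phi then [g phi g] is a 1GD
   inverse. Such a [g] is the inverse of phi on W plus any {1}-inverse of phi
   compressed to U, V = W + U being the AST decomposition. *)

Require Import Defs.
From HB Require Import structures.
From mathcomp Require Import all_boot all_order all_algebra.
From mathcomp Require Import boolp classical_sets functions.

Set Implicit Arguments.
Unset Strict Implicit.
Unset Printing Implicit Defensive.

Import GRing.Theory.

Local Open Scope classical_set_scope.
Local Open Scope ring_scope.

(** * Linear maps, subspaces and complements *)

Lemma iter_is_linear (k : fieldType) (V : lmodType k) (phi : {linear V -> V}) n :
  linear (iter n phi).
Proof. by elim: n => [//|n IH] a u v /=; rewrite IH linearP. Qed.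

HB.instance Definition _ (k : fieldType) (V : lmodType k) (phi : {linear V -> V}) n :=
  GRing.isLinear.Build k V V *:%R (iter n phi) (iter_is_linear phi n).

(** Antisymmetry asks for Leibniz equality: function extensionality identifies the underlying maps,
    proof irrelevance their linearity proofs. *)
Lemma linear_ext (k : fieldType) (V : lmodType k) (phi psi : {linear V -> V}) :
  phi =1 psi -> phi = psi.
Proof.
case: phi psi => [f [[fD] [fZ]]] [g [[gD] [gZ]]] /= /funext fg.
move: fD fZ; rewrite fg => fD fZ.
by rewrite (Prop_irrelevance fD gD) (Prop_irrelevance fZ gZ).
Qed.

Lemma subspaceP (k : fieldType) (V : lmodType k) (W : set V) :
  subspace W <-> W 0 /\ forall a u v, W u -> W v -> W (a *: u + v).
Proof.
split=> [[W0 Wl]|[W0 Wl]].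
  split=> [|a u v Wu Wv]; first by move: W0; rewrite inE.
  by have := Wl a u v; rewrite !inE; apply.
by split=> [|a u v]; rewrite !inE //; apply: Wl.
Qed.

Lemma subspaceB (k : fieldType) (V : lmodType k) (W : set V) u v :
  subspace W -> W u -> W v -> W (u - v).
Proof. by move=> /subspaceP[_ Wl] Wu Wv; rewrite addrC -scaleN1r; apply: Wl. Qed.

(** Subtracting two values at the same point and using the last hypothesis shows that [R] is
    single-valued, so a choice function for it is automatically linear. Projections and generalized
    inverses are built this way, without bases. *)
Lemma linear_choice (k : fieldType) (V : lmodType k) (R : V -> V -> Prop) :
  (forall v, exists w, R v w) ->
  (forall a u v u' v', R u u' -> R v v' -> R (a *: u + v) (a *: u' + v')) ->
  (forall w, R 0 w -> w = 0) ->
  exists f : {linear V -> V}, forall v, R v (f v).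
Proof.
move=> Rtot Rlin R0.
have [f Rf] := choice Rtot.
have Runiq u v w : R u v -> R u w -> v = w.
  move=> Ruv Ruw; apply/eqP; rewrite -subr_eq0; apply/eqP/R0.
  by have := Rlin (-1) _ _ _ _ Ruw Ruv; rewrite !scaleN1r addNr addrC.
have flin : linear f.
  by move=> a u v; apply: (Runiq (a *: u + v)); [exact: Rf|apply: Rlin; exact: Rf].
pose fM := GRing.isLinear.Build k V V *:%R f flin.
pose fL : {linear V -> V} := HB.pack f fM.
by exists fL.
Qed.

Lemma direct_sum_projection (k : fieldType) (V : lmodType k) (W U : set V) :
  subspace W -> subspace U -> direct_sum_decomposition W U ->
  exists p : {linear V -> V}, forall v, W (p v) /\ U (v - p v).
Proof.
move=> /subspaceP[W0 Wl] Us [WU0 WUtot].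
have [U0 Ul] := (subspaceP _).1 Us.
apply: (@linear_choice _ _ (fun v w => W w /\ U (v - w))).
- move=> v; have [w [u [Ww Uu ->]]] := WUtot v.
  by exists w; rewrite addrC addKr.
- move=> a u v u' v' [Wu' Uu] [Wv' Uv]; split; first exact: Wl.
  by have := Ul a _ _ Uu Uv; rewrite scalerBr opprD addrACA.
- move=> w [Ww]; rewrite sub0r => Uw.
  have : (W `&` U) w.
    by split=> //; rewrite -[w]opprK -sub0r; apply: subspaceB.
  by rewrite WU0.
Qed.

Lemma subspace_complement (k : fieldType) (V : lmodType k) (K : set V) :
  subspace K -> exists2 S, subspace S & direct_sum_decomposition K S.
Proof.
move=> Ks; have [K0 Kl] := (subspaceP _).1 Ks.
(* [0] is not required to lie in [S], since the empty chain has an empty union. *)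
pose P (S : set V) := (forall a u v, S u -> S v -> S (a *: u + v)) /\
  (forall v, K v -> S v -> v = 0).
have [|S [[Sl SK] Smax]] := @Zorn_bigcup V P.
  move=> F FP Ftot; split=> [a u v [A FA Au] [B FB Bv]|v Kv [A FA Av]].
    have [AB|BA] := Ftot _ _ FA FB.
      by exists B => //; apply: (FP _ FB).1 => //; apply: AB.
    by exists A => //; apply: (FP _ FA).1 => //; apply: BA.
  exact: (FP _ FA).2.
have {}Smax (B : set V) : S `<=` B -> P B -> B `<=` S.
  by move=> SB PB; apply: contrapT => BS; apply: (Smax B).
have S0 : S 0.
  have P0 : P [set 0].
    by split=> [a u v /= -> ->|v _ //]; rewrite scaler0 addr0.
  apply: contrapT => nS0.
  (* If 0 is not in [S], then [S] is empty, and maximality against the zero subspace puts 0 in [S]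
     after all. *)
  suff SE : S `<=` [set 0] by apply/nS0/(Smax _ SE P0).
  by move=> u Su; case: nS0; rewrite -[0](addNr u) -scaleN1r; apply: Sl.
have Ssub : subspace S by apply/subspaceP.
exists S => //; split; first by apply/seteqP; split=> [v [Kv Sv]|v ->] //=; apply: SK.
move=> v; apply: contrapT => nv.
(* The sum of the line through [v] and [S] still meets [K] trivially when [v] is outside K + S;
   maximality then puts [v] in [S], a contradiction. *)
pose B := [set w | exists a s, S s /\ w = a *: v + s].
have SB : S `<=` B by move=> s Ss; exists 0, s; rewrite scale0r add0r.
have Bv : B v by exists 1, 0; rewrite scale1r addr0.
suff PB : P B.
  by apply: nv; exists 0, v; split; [|apply: (Smax B)|rewrite add0r].
split=> [a _ _ [b [s [Ss ->]]] [c [t [St ->]]]|w Kw [a [s [Ss wE]]]].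
  exists (a * b + c), (a *: s + t); split; first exact: Sl.
  by rewrite scalerDl scalerDr scalerA addrACA.
have [a0|a0] := eqVneq a 0.
  by move: wE; rewrite a0 scale0r add0r => wE; apply: SK => //; rewrite wE.
case: nv; exists (a^-1 *: w), (- (a^-1 *: s)); split.
- by rewrite -[_ *: w]addr0; apply: Kl.
- by rewrite -sub0r; apply: subspaceB => //; rewrite -[_ *: s]addr0; apply: Sl.
- by rewrite wE scalerDr scalerA mulVf // scale1r addrK.
Qed.

(** * Kernels, ranges and {1}-inverses *)

Lemma subspace_ker (k : fieldType) (V : lmodType k) (phi : {linear V -> V}) :
  subspace [set v | phi v = 0].
Proof.
apply/subspaceP; split=> [|a u v /= u0 v0]; first exact: linear0.
by rewrite linearP u0 v0 scaler0 addr0.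
Qed.

Lemma subspace_range (k : fieldType) (V : lmodType k) (phi : {linear V -> V}) :
  subspace (range phi).
Proof.
apply/subspaceP; split; first by exists 0 => //; exact: linear0.
by move=> a _ _ [u _ <-] [v _ <-]; exists (a *: u + v) => //; rewrite linearP.
Qed.

(** Let [p] project onto the kernel and [q] onto the range. Sending v to x - p x, for any preimage x
    of q v, is independent of x, because two preimages differ by a kernel vector, which [p]
    fixes. *)
Lemma inverse1_exists (k : fieldType) (V : lmodType k) (phi : {linear V -> V}) :
  exists g : {linear V -> V}, inverse1 phi g.
Proof.
have projection K : subspace K ->
    exists p : {linear V -> V}, forall v, K (p v) /\ (K v -> p v = v).
  move=> Ks; have [S Ss KS] := subspace_complement Ks.
  have [p pP] := direct_sum_projection Ks Ss KS.
  exists p => v; have [Kpv Spv] := pP v; split=> // Kv.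
  have : (K `&` S) (v - p v) by split=> //; apply: subspaceB.
  by rewrite KS.1 => /eqP; rewrite subr_eq0 => /eqP.
have [p pP] := projection _ (subspace_ker phi).
have [q qP] := projection _ (subspace_range phi).
have [|||g gP] := @linear_choice _ _
    (fun v w => exists2 x, phi x = q v & w = x - p x).
- move=> v; have [[x _ xE] _] := qP v.
  by exists (x - p x), x.
- move=> a u v _ _ [x xE ->] [y yE ->]; exists (a *: x + y).
    by rewrite !linearP xE yE.
  by rewrite linearP scalerBr opprD addrACA.
- by move=> w [x]; rewrite linear0 => /(pP x).2 -> ->; rewrite subrr.
exists g => v /=; have [x xE ->] := gP (phi v).
by rewrite linearB xE (pP x).1 subr0; apply: (qP _).2; exists v.
Qed.

(** * Stable ranges and the AST decomposition *)

Lemma linear_span_drop (k : fieldType) (V : lmodType k) d (b c : 'I_d.+1 -> _) i :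
  \sum_j c j *: (b j : V) = 0 -> c i != 0 :> k ->
  linear_span b = linear_span (fun j => b (lift i j)).
Proof.
move=> cb0 ci0; apply/seteqP; split=> _ [e ->].
  exists (fun j => e (lift i j) - e i / c i * c (lift i j)).
  rewrite (bigD1_ord i) //=.
  have -> : b i = - (c i)^-1 *: \sum_j c (lift i j) *: b (lift i j).
    move: cb0; rewrite (bigD1_ord i) //= => /eqP; rewrite addr_eq0 => /eqP cbi.
    by rewrite scaleNr -scalerN -cbi scalerA mulVf // scale1r.
  rewrite scalerA scaler_sumr -big_split /=; apply: eq_bigr => j _.
  by rewrite scalerA -scalerDl addrC mulrN mulNr.
exists (fun j => oapp e 0 (unlift i j)).
rewrite (bigD1_ord i) //= unlift_none scale0r add0r.
by apply: eq_bigr => j _; rewrite liftK.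
Qed.

Lemma image_linear_span (k : fieldType) (V : lmodType k) (phi : {linear V -> V})
    d (b : 'I_d -> V) :
  phi @` linear_span b = linear_span (phi \o b).
Proof.
apply/seteqP; split=> [_ [_ [c ->] <-]|_ [c ->]].
  by exists c; rewrite linear_sum; apply: eq_bigr => i _; rewrite linearZ.
exists (\sum_i c i *: b i); first by exists c.
by rewrite linear_sum; apply: eq_bigr => i _; rewrite linearZ.
Qed.

(** Independence of the images makes the matrix [A] of coefficients row-free, hence invertible, and
    [invmx A] yields preimages. *)
Lemma endo_inj_surj (k : fieldType) (V : lmodType k) (phi : {linear V -> V})
    d (b : 'I_d -> V) :
  phi @` linear_span b `<=` linear_span b ->
  linearly_independent (phi \o b) ->
  set_surj (linear_span b) (linear_span b) phi.
Proof.
move=> stab indep.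
have /choice[M ME] i : exists c : 'I_d -> k, phi (b i) = \sum_j c j *: b j.
  apply: stab; exists (b i) => //; exists (fun j => (j == i)%:R).
  rewrite (bigD1 i) //= eqxx scale1r big1 ?addr0 // => j /negPf->.
  by rewrite scale0r.
pose A := \matrix_(i, j) M i j.
have sumE (c : 'rV_d) :
    phi (\sum_i c 0 i *: b i) = \sum_j (c *m A) 0 j *: b j.
  rewrite linear_sum.
  under eq_bigr do rewrite linearZ /= ME scaler_sumr.
  rewrite exchange_big; apply: eq_bigr => j _ /=.
  by rewrite mxE scaler_suml; apply: eq_bigr => i _; rewrite mxE scalerA.
have Aunit : A \in unitmx.
  rewrite -row_free_unit; apply: inj_row_free => c cA0; apply/rowP => i.
  rewrite mxE; apply: (indep (c 0)).
  have := sumE c; rewrite cA0 linear_sum.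
  under eq_bigr do rewrite linearZ /=.
  by move=> ->; rewrite big1 // => j _; rewrite mxE scale0r.
move=> _ [c ->]; pose r := (\row_i c i) *m invmx A.
exists (\sum_i r 0 i *: b i); first by exists (r 0).
by rewrite sumE mulmxKV //; apply: eq_bigr => i _; rewrite mxE.
Qed.

(* A spanning family of least size among those of all the ranges of [phi ^ n]
   stays independent when [phi] is applied to it: otherwise a vector could be
   dropped. *)
Lemma finite_potent_stable_range (k : fieldType) (V : lmodType k)
    (phi : {linear V -> V}) :
  finite_potent phi ->
  exists n, finite_dimensional (range (iter n phi)) /\
    set_bij (range (iter n phi)) (range (iter n phi)) phi.
Proof.
move=> [n0 _ [d0 [b0 [_ rE0]]]].
pose Q d := `[< exists n, exists b : 'I_d -> V, range (iter n phi) = linear_span b >].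
have exQ : exists d, Q d by exists d0; apply/asboolP; exists n0, b0.
have [d /asboolP[n [b rE]] dmin] := ex_minnP exQ.
have indep m (b' : 'I_d -> V) :
    range (iter m phi) = linear_span b' -> linearly_independent b'.
  case: d b' dmin {b rE} => [|d] b' dmin rE'; first by move=> c _ [].
  move=> c cb0 i; apply: contrapT => /eqP ci0.
  suff /dmin : Q d by rewrite ltnn.
  by apply/asboolP; exists m, (fun j => b' (lift i j)); rewrite rE' (linear_span_drop cb0 ci0).
have rS : phi @` range (iter n phi) = range (iter n.+1 phi).
  by rewrite image_comp.
have rSE : range (iter n.+1 phi) = linear_span (phi \o b).
  by rewrite -rS rE image_linear_span.
have stab : phi @` range (iter n phi) `<=` range (iter n phi).
  by rewrite rS => _ [v _ <-]; exists (phi v) => //; rewrite -iterSr.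
exists n; split; first by exists d, b; split=> //; apply: indep rE.
split.
- by move=> v rv; apply: stab; exists v.
- move=> u v ru rv uv; apply/eqP; rewrite -subr_eq0; apply/eqP.
  move: ru rv; rewrite !in_setE => ru rv.
  have := subspaceB (subspace_range (iter n phi)) ru rv.
  rewrite rE => -[c cE]; rewrite cE big1 // => i _.
  rewrite (indep _ _ rSE c) ?scale0r //.
  under eq_bigr do rewrite /= -linearZ.
  by rewrite -linear_sum -cE linearB uv subrr.
- rewrite rE in stab *; apply: endo_inj_surj => //; exact: indep rSE.
Qed.

Lemma iter_fixed_inj (k : fieldType) (V : lmodType k) (phi : {linear V -> V}) W n v :
  subspace W -> set_bij W W phi -> W v -> iter n phi v = 0 -> v = 0.
Proof.
move=> /subspaceP[W0 _] [Wphi Winj _].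
elim: n v => [//|n IH] v Wv; rewrite iterSr => /IH phiv0.
apply: Winj; rewrite ?in_setE // linear0; exact/phiv0/Wphi.
Qed.

(** Fitting decomposition: W is the stable range of phi^n and U the kernel of phi^n. *)
Lemma index_exists (k : fieldType) (V : lmodType k) (phi : {linear V -> V}) :
  finite_potent phi -> exists m, is_index phi m.
Proof.
move=> /finite_potent_stable_range[n [Wfin Wbij]].
set W := range _ in Wfin Wbij; pose U := [set v | iter n phi v = 0].
have Ws : subspace W by exact: subspace_range.
have [Wphi Winj Wsurj] := Wbij.
have Wsurjn j w : W w -> exists2 w', W w' & iter j phi w' = w.
  elim: j w => [|j IH] w Ww; first by exists w.
  have [w' Ww' <-] := Wsurj w Ww; have [w'' Ww'' <-] := IH w' Ww'.
  by exists w''.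
pose Q m := `[< power_zero_on phi U m >].
have exQ : exists m, Q m by exists n; apply/asboolP.
have [m /asboolP Um mmin] := ex_minnP exQ.
exists m, W, U; split; last by split=> // j Uj; apply: mmin; apply/asboolP.
split=> //.
- split=> //; exact: subspace_ker.
- split.
    apply/seteqP; split=> [v [Wv Uv]|v ->]; first exact: (iter_fixed_inj Ws Wbij Wv Uv).
    by split; [exact: ((subspaceP _).1 Ws).1|exact: linear0].
  (* The W-component of [v] is the vector of W with the same image under phi^n. *)
  move=> v; have [|w Ww wE] := Wsurjn n (iter n phi v); first by exists v.
  exists w, (v - w); split=> //; last by rewrite addrC subrK.
  by rewrite /U /= linearB /= wE subrr.
- by split=> // v; rewrite /U /= -iterSr /= => ->; rewrite linear0.
- by exists n.
Qed.

(** * G-Drazin inverses and the index *)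

Lemma GDrazin_inverse_exists (k : fieldType) (V : lmodType k)
    (phi : {linear V -> V}) :
  finite_potent phi -> exists g : {linear V -> V}, GDrazin_inverse phi g.
Proof.
move=> /index_exists[m im].
have [W [U [[[Ws Us] WU [Wphi Uphi] [_ Wbij] _] [Um _]]]] := im.
have [_ Winj Wsurj] := Wbij.
have [p pP] := direct_sum_projection Ws Us WU.
have puniq v w : W w -> U (v - w) -> p v = w.
  move=> Ww Uvw; have [Wpv Upv] := pP v.
  have : (W `&` U) (p v - w).
    split; first exact: subspaceB.
    by have := subspaceB Us Uvw Upv; rewrite opprB addrC addrA subrK.
  by rewrite WU.1 => /eqP; rewrite subr_eq0 => /eqP.
have pphi v : p (phi v) = phi (p v).
  have [Wpv Upv] := pP v; apply: puniq; first exact: Wphi.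
  by rewrite -linearB; apply: Uphi.
have pidem v : p (p v) = p v.
  have [Wpv _] := pP v; apply: puniq => //; rewrite subrr.
  exact: ((subspaceP _).1 Us).1.
(* [h] inverts phi on W and vanishes on U; it is single-valued because phi is injective on W. *)
have [|||h hP] := @linear_choice _ _ (fun v w => W w /\ phi w = p v).
- by move=> v; have [w Ww wE] := Wsurj _ (pP v).1; exists w.
- move=> a u v u' v' [Wu' u'E] [Wv' v'E].
  by split; [exact: ((subspaceP _).1 Ws).2|rewrite !linearP u'E v'E].
- by move=> w [Ww]; rewrite linear0; apply: (@iter_fixed_inj _ _ phi W 1 w Ws Wbij Ww).
have phih v : phi (h v) = p v by have [] := hP v.
have hphi v : h (phi v) = p v.
  apply: Winj; rewrite ?in_setE; [exact: (hP _).1|exact: (pP _).1|].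
  by rewrite phih.
have [g gP] := inverse1_exists phi.
have [r rE] : exists r : {linear V -> V}, forall v, r v = v - p v.
  by exists (idfun \- p : {linear V -> V}).
have rphi v : r (phi v) = phi (r v) by rewrite !rE linearB pphi.
have rpow v : iter m phi (r v) = 0 by apply: Um; rewrite rE; exact: (pP v).2.
have iter_comm (f : V -> V) j v : (forall v, f (phi v) = phi (f v)) ->
    f (iter j phi v) = iter j phi (f v).
  by move=> fphi; elim: j => //= j IH; rewrite fphi IH.
(* [r] projects onto U and commutes with phi, so phi^m kills the second summand on either side; [h]
   commutes with phi, both products being [p]. *)
exists (h \+ (r \o g \o r) : {linear V -> V}); split.
  move=> v /=; rewrite linearD phih pphi -rphi (rphi v).
  have -> : phi (g (phi (r v))) = phi (r v) by exact: gP.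
  by rewrite !rE pphi (linearB p) pidem subrr linear0 subr0 linearB addrC subrK.
exists m => // v /=; rewrite linearD /= rpow addr0.
rewrite (iter_comm r) // rpow !linear0 addr0.
by apply: iter_comm => w; rewrite hphi phih.
Qed.

(** phi^m kills the U-component of [v], and the powers of phi are injective on W. *)
Lemma index_ker_stable (k : fieldType) (V : lmodType k) (phi : {linear V -> V}) m j v :
  is_index phi m -> iter (j + m) phi v = 0 -> iter m phi v = 0.
Proof.
move=> [W [U [[[Ws _] [_ WU] _ [_ Wbij] _] [Um _]]]].
have [w [u [Ww Uu ->]]] := WU v.
rewrite iterD linearD /= (Um _ Uu) addr0 -iterD => w0.
by rewrite (iter_fixed_inj Ws Wbij Ww w0) linear0.
Qed.

Lemma index0_surj (k : fieldType) (V : lmodType k) (phi : {linear V -> V}) v :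
  is_index phi 0 -> exists w, phi w = v.
Proof.
move=> [W [U [[_ [_ WU] _ [_ [_ _ Wsurj]] _] [U0 _]]]].
have [w [u [Ww /U0 /= -> ->]]] := WU v.
by rewrite addr0; have [x _ <-] := Wsurj w Ww; exists x.
Qed.

(** For positive m, commutation turns phi^(m+1) g into phi g phi^m, which is phi^m by the
    {1}-inverse law. For m = 0 commutation says nothing, but phi is then surjective. *)
Lemma GDrazin_power (k : fieldType) (V : lmodType k) (phi g : {linear V -> V}) m v :
  is_index phi m -> inverse1 phi g -> g \o iter m phi =1 iter m phi \o g ->
  iter m phi (phi (g v)) = iter m phi v.
Proof.
move=> im gP; case: m im => [im _|m _ gm] /=.
  by have [w <-] := index0_surj v im; apply: gP.
rewrite -iterS -iterSr iterS; have /= <- := gm v; exact: gP.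
Qed.

(** * The order axioms *)

Lemma inverse1GD_inverse1 (k : fieldType) (V : lmodType k)
    (phi chi : {linear V -> V}) :
  inverse1GD phi chi -> inverse1 phi chi.
Proof.
move=> [_ [g [_ [gP _ chiphi _]]]] v /=.
by have /= -> := chiphi v; apply: gP.
Qed.

Lemma le1GD_refl (k : fieldType) (V : lmodType k) (phi : {linear V -> V}) :
  finite_potent phi -> le1GD phi phi.
Proof.
move=> /GDrazin_inverse_exists[g [gP gm]].
suff chiP : inverse1GD phi (g \o phi \o g) by exists (g \o phi \o g), (g \o phi \o g).
have gE v : phi (g (phi v)) = phi v by exact: gP.
split=> [v|]; first by rewrite /= !gE.
by exists g, g; split=> // v /=; rewrite gE.
Qed.

(** The product phi chi2 psi equals phi, as chi2 psi = chi2 phi, and equals psi, as psi = phi chi1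
    psi. *)
Lemma le1GD_anti (k : fieldType) (V : lmodType k) (phi psi : {linear V -> V}) :
  le1GD phi psi -> le1GD psi phi -> phi =1 psi.
Proof.
move=> [_ [chi2 [_ /inverse1GD_inverse1 chi2P _ chi2E]]].
move=> [chi1 [_ [/inverse1GD_inverse1 chi1P _ chi1E _]]] v.
have psiE : psi v = phi (chi1 (psi v)).
  exact: etrans (esym (chi1P v)) (chi1E (psi v)).
have /= <- := chi2P v; have /= -> := chi2E v.
by rewrite psiE; apply: chi2P.
Qed.

Lemma le1GD_trans (k : fieldType) (V : lmodType k) (psi phi omega : {linear V -> V}) :
  le1GD phi psi -> le1GD psi omega -> le1GD phi omega.
Proof.
move=> [a [b [aGD bGD phia bphi]]] [c [d [cGD dGD psic dpsi]]].
have [aphia [_ [ga [_ gaGD _ phiga]]]] := aGD.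
have [bphib [fb [gb [fbP [gbP [m im gbm]] bfb phigb]]]] := bGD.
have [_ [_ [gd [_ [gdP [m' im' gdm]] _ psigd]]]] := dGD.
have aP := inverse1GD_inverse1 aGD; have bP := inverse1GD_inverse1 bGD.
have cP := inverse1GD_inverse1 cGD; have dP := inverse1GD_inverse1 dGD.
rewrite /inverse1 /eqfun /= in aP bP cP dP.
rewrite /eqfun /= in phia bphi psic dpsi aphia phiga bphib bfb phigb psigd.
(* phi factors through psi on both sides, so {1}-inverses of psi cancel next to it: phi c psi = phi
   and psi d phi = phi. *)
have psia v : phi v = psi (a (phi v)) by rewrite -phia aP.
have phib v : phi v = phi (b (psi v)) by rewrite -bphi bP.
have phic v : phi (c (psi v)) = phi v by rewrite phib cP -phib.
have psid v : psi (d (phi v)) = phi v by rewrite psia dP.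
have phi_psi v : iter m phi (phi v) = iter m phi (psi v).
  by rewrite phib phigb; exact: GDrazin_power im gbP gbm.
have pow_phi_psi j v : iter m phi (iter j phi v) = iter m phi (iter j psi v).
  have iter_phi w : iter m phi (phi w) = phi (iter m phi w) by rewrite -iterSr.
  by elim: j => [//|j IH] /=; rewrite -phi_psi !iter_phi IH.
have pow_d v : iter m phi (psi (d v)) = iter m phi v.
  apply/eqP; rewrite -subr_eq0 -linearB; apply/eqP.
  apply: (@index_ker_stable _ _ phi m m') => //.
  rewrite addnC iterD pow_phi_psi linearB /= psigd.
  by rewrite (GDrazin_power v im' gdP gdm) subrr linear0.
(* For positive m, phi^m takes values in the range of phi, where psi d is the identity; for m = 0
   this is [pow_d]. *)
have d_pow v : psi (d (iter m phi v)) = iter m phi v.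
  by case: (m) pow_d => [pow_d|m1 _]; [exact: pow_d|exact: psid].
exists (c \o psi \o a), (b \o psi \o d); split.
- split=> [v|]; first by rewrite /= phic aphia.
  (* c psi a is its own {1}-inverse witness, and phi c psi a = phi a keeps the G-Drazin inverse
     [ga]. *)
  exists (c \o psi \o a), ga; split=> // v /=; first by rewrite phic aP.
  by rewrite phic phiga.
- split=> [v|]; first by rewrite /= psid bphib.
  (* Since psi d is absorbed by phi^m on both sides, gb psi d commutes with phi^m as [gb] does. *)
  exists fb, (gb \o psi \o d); split=> [//||v|v] /=.
  + split=> [v|]; first by rewrite /= psid; apply: gbP.
    by exists m => // v /=; rewrite d_pow -[RHS]gbm /= pow_d.
  + by rewrite psid; apply: bfb.
  + exact: phigb.
- by move=> v /=; rewrite phic -psic cP phia.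
- by move=> v /=; rewrite psid -dpsi dP bphi.
Qed.

Theorem theorem4p31 (k : fieldType) (V : lmodType k) :
  [/\ (forall phi : {linear V -> V}, finite_potent phi -> le1GD phi phi),
      (forall phi psi : {linear V -> V},
         finite_potent phi -> finite_potent psi ->
         le1GD phi psi -> le1GD psi phi -> phi = psi)
    & (forall phi psi omega : {linear V -> V},
         finite_potent phi -> finite_potent psi -> finite_potent omega ->
         le1GD phi psi -> le1GD psi omega -> le1GD phi omega)].
Proof.
split=> [phi|phi psi _ _ le1 le2|phi psi omega _ _ _]; first exact: le1GD_refl.
  exact/linear_ext/le1GD_anti.
exact: le1GD_trans.
Qed.
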